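(* Let $d \geq 2$ be an integer and let $G$ be a standard Gaussian random vector in $\mathbb{R}^d$ (mean zero, identity covariance). Then \[ \mathbb{P}(\|G\| > \sqrt{d}) \geq \frac{1}{33} \quad\text{and}\quad \mathbb{P}(\|G\| > \sqrt{d+2}) \geq \frac{1}{397}. \]
   Context: $\|\cdot\|$ denotes the standard Euclidean norm on $\mathbb{R}^d$. *)

(* Defs.v *)
(* No measure theory is installed, so the
   Gaussian probability of an (open) set is expressed as the iterated
   improper Riemann integral of its indicator against the standard Gaussian
   density on R^d (points of R^d are lists of length d). *)
From Stdlib Require Import Reals Lra List.
Open Scope R_scope.

Definition sqnorm (v : list R) : R := fold_right (fun x s => x * x + s) 0 v.
Definition enorm (v : list R) : R := sqrt (sqnorm v).

Definition gauss_density (d : nat) (v : list R) : R :=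
  exp (- sqnorm v / 2) / (sqrt (2 * PI)) ^ d.

Definition improper_int (f : R -> R) (l : R) : Prop :=
  (forall a b : R, inhabited (Riemann_integrable f a b)) /\
  (forall eps : R, eps > 0 -> exists M : R, forall a b : R,
      a <= - M -> M <= b ->
      exists pr : Riemann_integrable f a b, Rabs (RiemannInt pr - l) < eps).

Fixpoint iter_int (n : nat) (f : list R -> R) (l : R) : Prop :=
  match n with
  | O => f nil = l
  | S m => exists g : R -> R,
      (forall x : R, iter_int m (fun v => f (x :: v)) (g x)) /\ improper_int g l
  end.

Definition gauss_tail (d : nat) (r p : R) : Prop :=
  iter_int d (fun v => if Rlt_dec r (enorm v) then gauss_density d v else 0) p.

(* Main.v *)
(* P(||G|| > sqrt t0) is the probability that Z_d = X_1^2 + ... + X_d^2 exceeds t0.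
   Integrating out one coordinate at a time, it arises from the indicator of (t0, oo)
   by d applications of the monotone averaging operator g |-> (c |-> E g(c + X^2)),
   X standard normal.  Hence any polynomial p below that indicator gives
   P(Z_d > t0) >= E p(Z_d), which is explicit through the moments 1, 3, 15, 105 of
   X^2, X^4, X^6, X^8.  With k = sqrt (2 d) and u = (t - t0) / k, the quartic
   u (9/2 - u) (u + 3/2)^2 / 125 lies below the indicator, and E p(Z_d) is at least
   1/33 for t0 = d and at least 1/397 for t0 = d + 2. *)

Require Import Defs.
From Coquelicot Require Import Coquelicot.
From Stdlib Require Import Reals Lra ZArith Lia.
Open Scope R_scope.

Lemma ex_derive_continuous_R (f : R -> R) x : ex_derive f x -> continuous f x.
Proof. exact (ex_derive_continuous (K := R_AbsRing) (V := R_NormedModule) f x). Qed.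

Lemma ex_RInt_continuous_R (f : R -> R) a b :
  (forall z, Rmin a b <= z <= Rmax a b -> continuous f z) -> ex_RInt f a b.
Proof. exact (ex_RInt_continuous (V := R_CompleteNormedModule) f a b). Qed.

Lemma ex_RInt_scal_R (f : R -> R) k a b : ex_RInt f a b -> ex_RInt (fun x => k * f x) a b.
Proof. exact (ex_RInt_scal (V := R_NormedModule) f a b k). Qed.

Lemma ex_RInt_plus_R (f g : R -> R) a b :
  ex_RInt f a b -> ex_RInt g a b -> ex_RInt (fun x => f x + g x) a b.
Proof. exact (ex_RInt_plus (V := R_NormedModule) f g a b). Qed.

Lemma ex_RInt_ext_R (f g : R -> R) a b :
  (forall x, Rmin a b < x < Rmax a b -> f x = g x) -> ex_RInt f a b -> ex_RInt g a b.
Proof. exact (ex_RInt_ext (V := R_NormedModule) f g a b). Qed.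

Lemma ex_RInt_Chasles_R (f : R -> R) a b c :
  ex_RInt f a b -> ex_RInt f b c -> ex_RInt f a c.
Proof. exact (ex_RInt_Chasles (V := R_NormedModule) f a b c). Qed.

Lemma RInt_Chasles_R (f : R -> R) a b c :
  ex_RInt f a b -> ex_RInt f b c -> RInt f a b + RInt f b c = RInt f a c.
Proof. exact (RInt_Chasles (V := R_CompleteNormedModule) f a b c). Qed.

Lemma RInt_scal_R (f : R -> R) a b k :
  ex_RInt f a b -> RInt (fun x => k * f x) a b = k * RInt f a b.
Proof. exact (RInt_scal (V := R_CompleteNormedModule) f a b k). Qed.

Lemma RInt_plus_R (f g : R -> R) a b : ex_RInt f a b -> ex_RInt g a b ->
  RInt (fun x => f x + g x) a b = RInt f a b + RInt g a b.
Proof. exact (RInt_plus (V := R_CompleteNormedModule) f g a b). Qed.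

Lemma RInt_comp_lin_R (f : R -> R) u v a b : ex_RInt f (u * a + v) (u * b + v) ->
  RInt (fun y => u * f (u * y + v)) a b = RInt f (u * a + v) (u * b + v).
Proof. exact (RInt_comp_lin (V := R_CompleteNormedModule) f u v a b). Qed.

Lemma RInt_ext_R (f g : R -> R) a b :
  (forall x, Rmin a b < x < Rmax a b -> f x = g x) -> RInt f a b = RInt g a b.
Proof. exact (RInt_ext (V := R_CompleteNormedModule) f g a b). Qed.

Lemma RInt_const_R (c a b : R) : RInt (fun _ => c) a b = (b - a) * c.
Proof. exact (RInt_const (V := R_CompleteNormedModule) a b c). Qed.

Lemma RInt_ge_const (f : R -> R) a b m : a <= b -> ex_RInt f a b ->
  (forall x, a < x < b -> m <= f x) -> (b - a) * m <= RInt f a b.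
Proof. intros. rewrite <- RInt_const_R. apply RInt_le; auto. apply ex_RInt_const. Qed.

Lemma RInt_le_const (f : R -> R) a b m : a <= b -> ex_RInt f a b ->
  (forall x, a < x < b -> f x <= m) -> RInt f a b <= (b - a) * m.
Proof. intros. rewrite <- RInt_const_R. apply RInt_le; auto. apply ex_RInt_const. Qed.

Lemma ex_RInt_RInt_ext_R (f g : R -> R) a b : a <= b ->
  (forall x, a < x < b -> f x = g x) -> ex_RInt g a b ->
  ex_RInt f a b /\ RInt f a b = RInt g a b.
Proof.
  intros Hab E Hg.
  assert (E' : forall x, Rmin a b < x < Rmax a b -> g x = f x).
  { rewrite Rmin_left, Rmax_right by lra. intros; symmetry; auto. }
  split; [apply (ex_RInt_ext_R g); auto|].
  symmetry; apply RInt_ext_R; auto.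
Qed.

Lemma ex_RInt_sub (f : R -> R) N a b :
  ex_RInt f (- N) N -> Rabs a <= N -> Rabs b <= N -> ex_RInt f a b.
Proof.
  intros H Ha Hb. apply Rabs_le_between in Ha. apply Rabs_le_between in Hb.
  assert (Hsub : forall u v, - N <= u <= v -> v <= N -> ex_RInt f u v).
  { intros u v Huv Hv.
    apply (ex_RInt_Chasles_2 (V := R_CompleteNormedModule) f (- N)); [lra|].
    apply (ex_RInt_Chasles_1 (V := R_CompleteNormedModule) f (- N) v N); [lra | exact H]. }
  destruct (Rle_dec a b).
  - apply Hsub; lra.
  - apply (ex_RInt_swap (V := R_NormedModule)), Hsub; lra.
Qed.

(** * The Gaussian integral *)

Lemma exp_le x y : x <= y -> exp x <= exp y.
Proof. intros [H|H]; [left; apply exp_increasing, H | rewrite H; right; reflexivity]. Qed.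

Definition egauss (t : R) := exp (- (t * t)).

Lemma egauss_continuous t : continuous egauss t.
Proof. apply ex_derive_continuous_R; unfold egauss; auto_derive; auto. Qed.

Lemma ex_RInt_egauss a b : ex_RInt egauss a b.
Proof. apply ex_RInt_continuous_R; intros; apply egauss_continuous. Qed.

Lemma egauss_le_inv y : 0 < y -> egauss y <= / y.
Proof.
  intros Hy. unfold egauss; rewrite exp_Ropp. apply Rinv_le_contravar; [lra|].
  pose proof (exp_ineq1_le (y * y)). nra.
Qed.

Definition egauss_prim (x : R) := RInt egauss 0 x.

Lemma is_derive_egauss_prim x : is_derive egauss_prim x (egauss x).
Proof.
  apply (is_derive_RInt (V := R_NormedModule) egauss egauss_prim 0 x).
  - apply filter_forall; intros y.
    apply (RInt_correct (V := R_CompleteNormedModule)), ex_RInt_egauss.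
  - apply egauss_continuous.
Qed.

Lemma egauss_prim_ge0 x : 0 <= x -> 0 <= egauss_prim x.
Proof.
  intros Hx. apply Rle_trans with ((x - 0) * 0); [lra|].
  apply RInt_ge_const; [lra | apply ex_RInt_egauss |].
  intros t _; apply Rlt_le, exp_pos.
Qed.

Lemma egauss_prim_opp y : egauss_prim (- y) = - egauss_prim y.
Proof.
  unfold egauss_prim.
  pose proof (RInt_comp_lin_R egauss (-1) 0 0 y (ex_RInt_egauss _ _)) as H.
  replace (-1 * 0 + 0) with 0 in H by ring. replace (-1 * y + 0) with (- y) in H by ring.
  rewrite <- H, <- (Rmult_1_l (RInt egauss 0 y)), Ropp_mult_distr_l, <- RInt_scal_R
    by apply ex_RInt_egauss.
  apply RInt_ext_R; intros. unfold egauss. do 2 f_equal; ring.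
Qed.

(** The Gaussian integral, via the invariance of
    [(int_0^x e^(-t^2))^2 + int_0^1 e^(-x^2 (1+t^2)) / (1+t^2) dt],
    which equals [atan 1 = PI/4] at [x = 0] and tends to the square of the
    Gaussian integral as [x -> oo]. *)

Definition atan_kernel (u t : R) := exp (- (u * u) * (1 + t * t)) / (1 + t * t).

Definition atan_kernel_du (u t : R) := -2 * u * exp (- (u * u) * (1 + t * t)).

Lemma is_derive_atan_kernel u t : is_derive (fun z => atan_kernel z t) u (atan_kernel_du u t).
Proof.
  pose proof (Rle_0_sqr t). unfold atan_kernel, atan_kernel_du, Rsqr in *.
  auto_derive; [lra | field; lra].
Qed.

Lemma continuity_2d_pt_atan_kernel_du u t : continuity_2d_pt atan_kernel_du u t.
Proof.
  unfold atan_kernel_du.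
  apply continuity_2d_pt_mult.
  - apply continuity_2d_pt_mult; [apply continuity_2d_pt_const | apply continuity_2d_pt_id1].
  - apply continuity_1d_2d_pt_comp with (f := exp) (g := fun u v => - (u * u) * (1 + v * v)).
    + apply derivable_continuous_pt, derivable_pt_exp.
    + apply continuity_2d_pt_mult.
      * apply continuity_2d_pt_opp, continuity_2d_pt_mult; apply continuity_2d_pt_id1.
      * apply continuity_2d_pt_plus; [apply continuity_2d_pt_const|].
        apply continuity_2d_pt_mult; apply continuity_2d_pt_id2.
Qed.

Lemma ex_RInt_atan_kernel u a b : ex_RInt (atan_kernel u) a b.
Proof.
  apply ex_RInt_continuous_R; intros t _. apply ex_derive_continuous_R.
  pose proof (Rle_0_sqr t). unfold atan_kernel, Rsqr in *. auto_derive; lra.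
Qed.

Definition atan_int (x : R) := RInt (atan_kernel x) 0 1.

Lemma RInt_atan_kernel_du x : RInt (atan_kernel_du x) 0 1 = -2 * egauss x * egauss_prim x.
Proof.
  unfold egauss_prim.
  pose proof (RInt_comp_lin_R egauss x 0 0 1 (ex_RInt_egauss _ _)) as H.
  replace (x * 0 + 0) with 0 in H by ring. replace (x * 1 + 0) with x in H by ring.
  rewrite <- H, <- RInt_scal_R.
  - apply RInt_ext_R; intros t _. unfold atan_kernel_du, egauss.
    replace (- (x * x) * (1 + t * t)) with (- (x * x) + - ((x * t + 0) * (x * t + 0))) by ring.
    rewrite exp_plus; ring.
  - apply ex_RInt_continuous_R; intros; apply ex_derive_continuous_R.
    unfold egauss; auto_derive; auto.
Qed.

Lemma is_derive_atan_int x : is_derive atan_int x (-2 * egauss x * egauss_prim x).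
Proof.
  rewrite <- RInt_atan_kernel_du. unfold atan_int.
  replace (RInt (atan_kernel_du x) 0 1)
    with (RInt (fun t => Derive (fun u => atan_kernel u t) x) 0 1).
  2: { apply RInt_ext_R; intros; apply is_derive_unique, is_derive_atan_kernel. }
  apply (is_derive_RInt_param atan_kernel 0 1 x).
  - apply filter_forall; intros; eexists; apply is_derive_atan_kernel.
  - intros t _. eapply continuity_2d_pt_ext; [|apply (continuity_2d_pt_atan_kernel_du x t)].
    intros u v; symmetry; apply is_derive_unique, is_derive_atan_kernel.
  - apply filter_forall; intros; apply ex_RInt_atan_kernel.
Qed.

Definition gauss_invariant (x : R) := egauss_prim x * egauss_prim x + atan_int x.

Lemma gauss_invariant_const x : gauss_invariant x = PI / 4.
Proof.
  assert (Hd : forall y, derivable_pt_lim gauss_invariant y 0).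
  { intros y. apply is_derive_Reals.
    replace 0 with (egauss y * egauss_prim y + egauss_prim y * egauss y
                    + -2 * egauss y * egauss_prim y) by ring.
    apply (is_derive_plus (K := R_AbsRing) (V := R_NormedModule)).
    - apply (is_derive_mult (K := R_AbsRing)); try apply is_derive_egauss_prim.
      intros; apply Rmult_comm.
    - apply is_derive_atan_int. }
  assert (H0 : gauss_invariant 0 = PI / 4).
  { unfold gauss_invariant, egauss_prim, atan_int. rewrite RInt_point, <- atan_1.
    replace (atan 1) with (atan 1 - atan 0) by (rewrite atan_0; ring).
    unfold zero; simpl; rewrite Rmult_0_l, Rplus_0_l.
    rewrite (RInt_ext_R _ (fun t => / (1 + t * t))).
    2: { intros t _. unfold atan_kernel. replace (- (0 * 0) * (1 + t * t)) with 0 by ring.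
         rewrite exp_0. field. pose proof (Rle_0_sqr t); unfold Rsqr in *; lra. }
    apply is_RInt_unique.
    apply (is_RInt_derive (V := R_CompleteNormedModule) atan).
    - intros t _. exact (is_derive_atan t).
    - intros t _. apply ex_derive_continuous_R.
      pose proof (Rle_0_sqr t); unfold Rsqr in *; auto_derive; lra. }
  destruct (MVT_abs gauss_invariant (fun _ => 0) 0 x) as [c [Hc _]]; [intros; apply Hd|].
  rewrite Rabs_R0, Rmult_0_l in Hc. apply Rabs_eq_0 in Hc. lra.
Qed.

Lemma atan_int_bounds x : 0 <= atan_int x <= egauss x.
Proof.
  unfold atan_int. split.
  - apply Rle_trans with ((1 - 0) * 0); [lra|].
    apply RInt_ge_const; [lra | apply ex_RInt_atan_kernel |].
    intros t _. pose proof (Rle_0_sqr t); unfold Rsqr in *. unfold atan_kernel.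
    apply Rlt_le, Rdiv_lt_0_compat; [apply exp_pos | lra].
  - apply Rle_trans with ((1 - 0) * egauss x); [|lra].
    apply RInt_le_const; [lra | apply ex_RInt_atan_kernel |].
    intros t _. pose proof (Rle_0_sqr t); pose proof (Rle_0_sqr x); unfold Rsqr in *.
    unfold atan_kernel, egauss, Rdiv.
    assert (exp (- (x * x) * (1 + t * t)) <= exp (- (x * x))) by (apply exp_le; nra).
    assert (/ (1 + t * t) <= 1) by (rewrite <- Rinv_1; apply Rinv_le_contravar; lra).
    pose proof (exp_pos (- (x * x) * (1 + t * t))). nra.
Qed.

Definition half_sqrt_pi := sqrt PI / 2.

Lemma half_sqrt_pi_pos : 0 < half_sqrt_pi.
Proof. unfold half_sqrt_pi. pose proof (sqrt_lt_R0 _ PI_RGT_0). lra. Qed.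

Lemma egauss_prim_near_limit x : 0 <= x ->
  Rabs (egauss_prim x - half_sqrt_pi) <= egauss x / half_sqrt_pi.
Proof.
  intros Hx. pose proof (gauss_invariant_const x) as H. unfold gauss_invariant in H.
  pose proof (atan_int_bounds x). pose proof (egauss_prim_ge0 x Hx). pose proof half_sqrt_pi_pos.
  assert (Hsq : half_sqrt_pi * half_sqrt_pi = PI / 4).
  { unfold half_sqrt_pi. pose proof (sqrt_sqrt PI (Rlt_le _ _ PI_RGT_0)). nra. }
  assert (Hd : egauss_prim x - half_sqrt_pi = - atan_int x / (egauss_prim x + half_sqrt_pi)).
  { apply (Rmult_eq_reg_r (egauss_prim x + half_sqrt_pi)); [|lra].
    unfold Rdiv; rewrite Rmult_assoc, Rinv_l by lra. nra. }
  rewrite Hd. unfold Rdiv. rewrite Rabs_mult, Rabs_Ropp, Rabs_inv by lra.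
  rewrite (Rabs_right (atan_int x)), (Rabs_right (egauss_prim x + half_sqrt_pi)) by lra.
  apply Rmult_le_compat; try lra.
  - left; apply Rinv_0_lt_compat; lra.
  - apply Rinv_le_contravar; lra.
Qed.

(** * The standard normal density and integrals over the line *)

Definition phi (x : R) := exp (- (x * x) / 2) / sqrt (2 * PI).

Lemma sqrt_2PI_ge2 : 2 <= sqrt (2 * PI).
Proof.
  rewrite <- (sqrt_square 2) at 1 by lra. apply sqrt_le_1_alt. pose proof PI2_1. lra.
Qed.

Lemma phi_pos x : 0 < phi x.
Proof. pose proof sqrt_2PI_ge2. apply Rdiv_lt_0_compat; [apply exp_pos | lra]. Qed.

Lemma phi_le_exp x : phi x <= exp (- (x * x) / 2).
Proof.
  pose proof sqrt_2PI_ge2. pose proof (exp_pos (- (x * x) / 2)). unfold phi, Rdiv.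
  assert (/ sqrt (2 * PI) <= 1) by (rewrite <- Rinv_1; apply Rinv_le_contravar; lra).
  nra.
Qed.

Lemma phi_le_half x : phi x <= / 2.
Proof.
  pose proof sqrt_2PI_ge2. pose proof (exp_pos (- (x * x) / 2)). unfold phi, Rdiv.
  assert (exp (- (x * x) / 2) <= 1).
  { rewrite <- exp_0. apply exp_le. pose proof (Rle_0_sqr x). unfold Rsqr in *. lra. }
  assert (/ sqrt (2 * PI) <= / 2) by (apply Rinv_le_contravar; lra).
  pose proof (Rinv_0_lt_compat (sqrt (2 * PI))). nra.
Qed.

Lemma phi_continuous x : continuous phi x.
Proof. apply ex_derive_continuous_R; unfold phi; auto_derive; auto. Qed.

Lemma ex_RInt_phi a b : ex_RInt phi a b.
Proof. apply ex_RInt_continuous_R; intros; apply phi_continuous. Qed.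

Lemma RInt_phi a b :
  RInt phi a b = (egauss_prim (b / sqrt 2) - egauss_prim (a / sqrt 2)) / sqrt PI.
Proof.
  assert (H2 : 0 < sqrt 2) by (apply sqrt_lt_R0; lra).
  assert (HP : 0 < sqrt PI) by apply (sqrt_lt_R0 _ PI_RGT_0).
  pose proof (RInt_comp_lin_R egauss (/ sqrt 2) 0 a b (ex_RInt_egauss _ _)) as H.
  replace (/ sqrt 2 * a + 0) with (a / sqrt 2) in H by (unfold Rdiv; ring).
  replace (/ sqrt 2 * b + 0) with (b / sqrt 2) in H by (unfold Rdiv; ring).
  replace (egauss_prim (b / sqrt 2) - egauss_prim (a / sqrt 2))
    with (RInt egauss (a / sqrt 2) (b / sqrt 2)).
  2: { unfold egauss_prim.
       pose proof (RInt_Chasles_R egauss 0 (a / sqrt 2) (b / sqrt 2)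
                     (ex_RInt_egauss _ _) (ex_RInt_egauss _ _)). lra. }
  rewrite <- H. unfold Rdiv at 1. rewrite Rmult_comm, <- RInt_scal_R.
  2: { apply ex_RInt_continuous_R; intros; apply ex_derive_continuous_R.
       unfold egauss; auto_derive; auto. }
  apply RInt_ext_R; intros x _. unfold phi, egauss.
  rewrite (sqrt_mult 2 PI) by (pose proof PI_RGT_0; lra).
  replace (- ((/ sqrt 2 * x + 0) * (/ sqrt 2 * x + 0))) with (- (x * x) / (sqrt 2 * sqrt 2)).
  - rewrite sqrt_sqrt by lra. field; lra.
  - field; lra.
Qed.

Definition is_RInt_line (f : R -> R) (l : R) :=
  (forall a b, ex_RInt f a b) /\
  (forall eps, eps > 0 -> exists M, forall a b,
     a <= - M -> M <= b -> Rabs (RInt f a b - l) < eps).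

Lemma RInt_phi_sub_1 a b : a <= 0 -> 0 <= b ->
  Rabs (RInt phi a b - 1) <= 2 / PI * (egauss (b / sqrt 2) + egauss (- a / sqrt 2)).
Proof.
  intros Ha Hb.
  assert (H2 : 0 < sqrt 2) by (apply sqrt_lt_R0; lra).
  assert (HP : 0 < sqrt PI) by apply (sqrt_lt_R0 _ PI_RGT_0).
  pose proof half_sqrt_pi_pos. pose proof PI_RGT_0.
  assert (Hss : half_sqrt_pi * sqrt PI = PI / 2).
  { unfold half_sqrt_pi. pose proof (sqrt_sqrt PI (Rlt_le _ _ PI_RGT_0)). nra. }
  assert (Hy : forall y, 0 <= y ->
            Rabs ((egauss_prim y - half_sqrt_pi) / sqrt PI) <= 2 / PI * egauss y).
  { intros y Hy. rewrite Rabs_div, (Rabs_right (sqrt PI)) by lra.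
    replace (2 / PI * egauss y) with (egauss y / half_sqrt_pi / sqrt PI).
    2: { replace (2 / PI) with (/ (PI / 2)) by (field; lra). rewrite <- Hss. field; lra. }
    unfold Rdiv; apply Rmult_le_compat_r; [left; apply Rinv_0_lt_compat; lra|].
    apply egauss_prim_near_limit, Hy. }
  rewrite RInt_phi.
  replace (a / sqrt 2) with (- (- a / sqrt 2)) by (unfold Rdiv; ring).
  rewrite egauss_prim_opp.
  replace ((egauss_prim (b / sqrt 2) - - egauss_prim (- a / sqrt 2)) / sqrt PI - 1)
    with ((egauss_prim (b / sqrt 2) - half_sqrt_pi) / sqrt PI
          + (egauss_prim (- a / sqrt 2) - half_sqrt_pi) / sqrt PI)
    by (unfold half_sqrt_pi; field; lra).
  eapply Rle_trans; [apply Rabs_triang|].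
  pose proof (Hy (b / sqrt 2) ltac:(apply Rdiv_le_0_compat; lra)).
  pose proof (Hy (- a / sqrt 2) ltac:(apply Rdiv_le_0_compat; lra)).
  lra.
Qed.

Lemma is_RInt_line_phi : is_RInt_line phi 1.
Proof.
  split; [apply ex_RInt_phi|]. intros eps Heps.
  assert (H2 : 0 < sqrt 2) by (apply sqrt_lt_R0; lra).
  pose proof PI_RGT_0.
  set (M := 4 / (PI * eps) + 1).
  assert (HM0 : 0 < M) by (pose proof (Rdiv_lt_0_compat 4 (PI * eps)); unfold M; nra).
  assert (Htail : forall y, M <= y -> egauss y <= / M).
  { intros y Hy. eapply Rle_trans; [apply egauss_le_inv; lra | apply Rinv_le_contravar; lra]. }
  exists (sqrt 2 * M). intros a b Ha Hb.
  pose proof (Htail (b / sqrt 2) ltac:(apply Rle_div_r; lra)).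
  pose proof (Htail (- a / sqrt 2) ltac:(apply Rle_div_r; lra)).
  eapply Rle_lt_trans; [apply RInt_phi_sub_1; nra|].
  apply Rle_lt_trans with (2 / PI * (2 / M)).
  { apply Rmult_le_compat_l; [apply Rlt_le, Rdiv_lt_0_compat|]; lra. }
  replace (2 / PI * (2 / M)) with (4 / (PI * eps) * (eps / M)) by (field; lra).
  apply Rlt_le_trans with (M * (eps / M)); [|right; field; lra].
  apply Rmult_lt_compat_r; [apply Rdiv_lt_0_compat; lra | unfold M; lra].
Qed.

Lemma is_RInt_line_ext f g l : (forall x, f x = g x) -> is_RInt_line f l -> is_RInt_line g l.
Proof.
  intros E [Hex Hlim]. split.
  - intros a b. apply (ex_RInt_ext_R f); auto.
  - intros eps Heps. destruct (Hlim eps Heps) as [M HM]. exists M. intros a b Ha Hb.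
    rewrite <- (RInt_ext_R f g) by auto. auto.
Qed.

Lemma is_RInt_line_scal f l k : is_RInt_line f l -> is_RInt_line (fun x => k * f x) (k * l).
Proof.
  intros [Hex Hlim]. split; [intros; apply ex_RInt_scal_R, Hex|].
  intros eps Heps. pose proof (Rabs_pos k).
  destruct (Hlim (eps / (Rabs k + 1))) as [M HM]; [apply Rdiv_lt_0_compat; lra|].
  exists M. intros a b Ha Hb. specialize (HM a b Ha Hb).
  rewrite RInt_scal_R by apply Hex.
  replace (k * RInt f a b - k * l) with (k * (RInt f a b - l)) by ring.
  rewrite Rabs_mult. pose proof (Rabs_pos (RInt f a b - l)).
  apply Rle_lt_trans with ((Rabs k + 1) * Rabs (RInt f a b - l)); [nra|].
  apply (Rmult_lt_reg_l (/ (Rabs k + 1))); [apply Rinv_0_lt_compat; lra|].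
  rewrite <- Rmult_assoc, Rinv_l by lra. unfold Rdiv in HM. lra.
Qed.

Lemma is_RInt_line_plus f g l1 l2 : is_RInt_line f l1 -> is_RInt_line g l2 ->
  is_RInt_line (fun x => f x + g x) (l1 + l2).
Proof.
  intros [Fex Flim] [Gex Glim]. split; [intros; apply ex_RInt_plus_R; auto|].
  intros eps Heps.
  destruct (Flim (eps / 2)) as [M1 HM1]; [lra|]. destruct (Glim (eps / 2)) as [M2 HM2]; [lra|].
  exists (Rmax M1 M2). intros a b Ha Hb. rewrite RInt_plus_R by auto.
  pose proof (Rmax_l M1 M2). pose proof (Rmax_r M1 M2).
  pose proof (HM1 a b ltac:(lra) ltac:(lra)). pose proof (HM2 a b ltac:(lra) ltac:(lra)).
  pose proof (Rabs_triang (RInt f a b - l1) (RInt g a b - l2)).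
  replace (RInt f a b + RInt g a b - (l1 + l2))
    with ((RInt f a b - l1) + (RInt g a b - l2)) by ring. lra.
Qed.

Lemma is_RInt_line_le f g l1 l2 : is_RInt_line f l1 -> is_RInt_line g l2 ->
  (forall x, f x <= g x) -> l1 <= l2.
Proof.
  intros [Fex Flim] [Gex Glim] Hle. apply Rnot_lt_le; intros Hlt.
  destruct (Flim ((l1 - l2) / 2)) as [M1 HM1]; [lra|].
  destruct (Glim ((l1 - l2) / 2)) as [M2 HM2]; [lra|].
  pose proof (Rmax_l (Rmax M1 M2) 0). pose proof (Rmax_r (Rmax M1 M2) 0).
  pose proof (Rmax_l M1 M2). pose proof (Rmax_r M1 M2).
  set (M := Rmax (Rmax M1 M2) 0) in *.
  pose proof (HM1 (- M) M ltac:(lra) ltac:(lra)) as A1.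
  pose proof (HM2 (- M) M ltac:(lra) ltac:(lra)) as A2.
  assert (RInt f (- M) M <= RInt g (- M) M) by (apply RInt_le; auto; lra).
  apply Rabs_def2 in A1. apply Rabs_def2 in A2. lra.
Qed.

Lemma is_RInt_line_unique f l1 l2 : is_RInt_line f l1 -> is_RInt_line f l2 -> l1 = l2.
Proof. intros. apply Rle_antisym; eapply is_RInt_line_le; eauto; intros; lra. Qed.

Lemma improper_int_of_is_RInt_line f l : is_RInt_line f l -> improper_int f l.
Proof.
  intros [Hex Hlim]. split.
  - intros a b. constructor. apply ex_RInt_Reals_0, Hex.
  - intros eps Heps. destruct (Hlim eps Heps) as [M HM]. exists M. intros a b Ha Hb.
    exists (ex_RInt_Reals_0 f a b (Hex a b)). rewrite <- RInt_Reals. auto.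
Qed.

Lemma nat_above M : exists N : nat, M <= INR N.
Proof.
  destruct (archimed M) as [H1 _].
  destruct (Z_le_gt_dec 0 (up M)) as [Hz|Hz].
  - exists (Z.to_nat (up M)). rewrite INR_IZR_INZ, Z2Nat.id by lia. lra.
  - exists 0%nat. apply Z.gt_lt, IZR_lt in Hz. simpl. lra.
Qed.

(* Junk value [0] when the limit does not exist. *)
Definition RInt_line (f : R -> R) := real (Lim_seq (fun k => RInt f (- INR k) (INR k))).

Section DominatedByPhi.

Variable f : R -> R.
Hypothesis f_ex : forall a b, ex_RInt f a b.
Hypothesis f_dom : forall x, Rabs (f x) <= phi x.

Lemma RInt_abs_le_phi a b : a <= b -> Rabs (RInt f a b) <= RInt phi a b.
Proof.
  intros Hab. apply Rabs_le_between. split.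
  - rewrite <- (Rmult_1_l (RInt phi a b)), Ropp_mult_distr_l, <- RInt_scal_R
      by apply ex_RInt_phi.
    apply RInt_le; auto; [apply ex_RInt_scal_R, ex_RInt_phi|].
    intros x _. pose proof (proj1 (Rabs_le_between _ _) (f_dom x)). lra.
  - apply RInt_le; auto; [apply ex_RInt_phi|].
    intros x _. pose proof (proj1 (Rabs_le_between _ _) (f_dom x)). lra.
Qed.

(* Tails of [f] are dominated by tails of [phi], which are small since [phi] has total mass 1. *)
Lemma RInt_cauchy_dominated eps : eps > 0 -> exists M,
  forall a1 b1 a2 b2, a1 <= - M -> M <= b1 -> a2 <= - M -> M <= b2 ->
    Rabs (RInt f a1 b1 - RInt f a2 b2) < eps.
Proof.
  intros Heps. destruct is_RInt_line_phi as [_ Hphi].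
  destruct (Hphi (eps / 4)) as [M HM]; [lra|]. exists M.
  assert (Hnest : forall a b a' b', a <= a' -> a' <= - M -> M <= b' -> b' <= b ->
            Rabs (RInt f a b - RInt f a' b') < eps / 2).
  { intros a b a' b' H1 H2 H3 H4.
    pose proof (HM a b ltac:(lra) ltac:(lra)) as P1.
    pose proof (HM a' b' ltac:(lra) ltac:(lra)) as P2.
    assert (Hex_phi : ex_RInt phi a' b) by apply ex_RInt_phi.
    assert (Hex_f : ex_RInt f a' b) by apply f_ex.
    rewrite <- (RInt_Chasles_R f a a' b), <- (RInt_Chasles_R f a' b' b) by auto.
    rewrite <- (RInt_Chasles_R phi a a' b), <- (RInt_Chasles_R phi a' b' b)
      in P1 by (auto; apply ex_RInt_phi).
    pose proof (RInt_abs_le_phi a a' H1) as Q1. pose proof (RInt_abs_le_phi b' b H4) as Q2.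
    apply Rabs_def2 in P1. apply Rabs_def2 in P2.
    apply Rabs_le_between in Q1. apply Rabs_le_between in Q2.
    apply Rabs_def1; lra. }
  intros a1 b1 a2 b2 H1 H2 H3 H4.
  pose proof (Hnest (Rmin a1 a2) (Rmax b1 b2) a1 b1 (Rmin_l _ _) H1 H2 (Rmax_l _ _)) as K1.
  pose proof (Hnest (Rmin a1 a2) (Rmax b1 b2) a2 b2 (Rmin_r _ _) H3 H4 (Rmax_r _ _)) as K2.
  apply Rabs_def2 in K1. apply Rabs_def2 in K2. apply Rabs_def1; lra.
Qed.

Lemma is_RInt_line_dominated : is_RInt_line f (RInt_line f).
Proof.
  set (u := fun k => RInt f (- INR k) (INR k)).
  assert (Hc : Cauchy_crit u).
  { intros eps Heps. destruct (RInt_cauchy_dominated eps Heps) as [M HM].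
    destruct (nat_above M) as [N HN]. exists N. intros n m Hn Hm. unfold R_dist, u.
    apply le_INR in Hn. apply le_INR in Hm. apply HM; lra. }
  destruct (R_complete u Hc) as [l Hl].
  replace (RInt_line f) with l.
  2: { unfold RInt_line. fold u. rewrite (is_lim_seq_unique u l); [reflexivity|].
       apply is_lim_seq_Reals, Hl. }
  split; [exact f_ex|]. intros eps Heps.
  destruct (RInt_cauchy_dominated (eps / 2)) as [M HM]; [lra|].
  exists M. intros a b Ha Hb.
  destruct (Hl (eps / 2)) as [N1 HN1]; [lra|].
  destruct (nat_above M) as [N2 HN2].
  set (k := max N1 N2).
  assert (INR N2 <= INR k) by apply le_INR, Nat.le_max_r.
  pose proof (HN1 k (Nat.le_max_l _ _)) as Hk. unfold R_dist, u in Hk.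
  pose proof (HM a b (- INR k) (INR k) Ha Hb ltac:(lra) ltac:(lra)).
  pose proof (Rabs_triang (RInt f a b - RInt f (- INR k) (INR k))
                          (RInt f (- INR k) (INR k) - l)).
  replace (RInt f a b - RInt f (- INR k) (INR k) + (RInt f (- INR k) (INR k) - l))
    with (RInt f a b - l) in * by ring.
  lra.
Qed.

End DominatedByPhi.

(** * Averaging over one standard normal coordinate *)

(* The first average of the indicator is only 1/2-Hoelder in [c], through
   [sqrt (r^2 - c)]; this regularity survives averaging and makes the next
   integrand Riemann integrable. *)
Definition holder_half (g : R -> R) := forall c c', Rabs (g c - g c') <= sqrt (Rabs (c - c')).

Lemma holder_half_continuity_pt g c : holder_half g -> continuity_pt g c.
Proof.
  intros H eps Heps. exists (eps * eps). split; [nra|].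
  intros x [_ Hx]. simpl in *. unfold R_dist in *.
  eapply Rle_lt_trans; [apply H|].
  rewrite <- (sqrt_square eps) by lra. apply sqrt_lt_1_alt. split; [apply Rabs_pos | exact Hx].
Qed.

Lemma sqrt_holder_half : holder_half (fun t => sqrt (Rmax 0 t)).
Proof.
  assert (Hle : forall u v, 0 <= v <= u -> Rabs (sqrt u - sqrt v) <= sqrt (Rabs (u - v))).
  { intros u v Huv. pose proof (sqrt_le_1_alt v u (proj2 Huv)).
    pose proof (sqrt_pos u). pose proof (sqrt_pos v).
    pose proof (sqrt_sqrt u ltac:(lra)). pose proof (sqrt_sqrt v ltac:(lra)).
    rewrite !Rabs_right by lra. rewrite <- (sqrt_square (sqrt u - sqrt v)) by lra.
    apply sqrt_le_1_alt. nra. }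
  intros c c'. pose proof (Rmax_l 0 c). pose proof (Rmax_l 0 c').
  apply Rle_trans with (sqrt (Rabs (Rmax 0 c - Rmax 0 c'))).
  - destruct (Rle_dec (Rmax 0 c') (Rmax 0 c)).
    + apply Hle; lra.
    + rewrite Rabs_minus_sym, (Rabs_minus_sym (Rmax 0 c)). apply Hle; lra.
  - apply sqrt_le_1_alt. unfold Rmax.
    destruct (Rle_dec 0 c), (Rle_dec 0 c'); unfold Rabs; repeat destruct Rcase_abs; lra.
Qed.

Definition avg_integrable (g : R -> R) :=
  forall c a b, ex_RInt (fun x => phi x * g (c + x * x)) a b.

Definition gauss_avg (g : R -> R) (c : R) := RInt_line (fun x => phi x * g (c + x * x)).

Lemma avg_integrable_holder_half g : holder_half g -> avg_integrable g.
Proof.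
  intros Hg c a b. apply ex_RInt_continuous_R. intros z _.
  apply continuity_pt_filterlim, continuity_pt_mult.
  - apply continuity_pt_filterlim, phi_continuous.
  - apply (continuity_pt_comp (fun x => c + x * x) g).
    + apply continuity_pt_filterlim, (ex_derive_continuous_R (fun x => c + x * x)).
      auto_derive; auto.
    + apply holder_half_continuity_pt, Hg.
Qed.

Section GaussAvg.

Variable g : R -> R.
Hypothesis g_bounds : forall t, 0 <= g t <= 1.
Hypothesis g_int : avg_integrable g.

Lemma is_RInt_line_gauss_avg c :
  is_RInt_line (fun x => phi x * g (c + x * x)) (gauss_avg g c).
Proof.
  apply is_RInt_line_dominated; [apply g_int|]. intros x.
  pose proof (g_bounds (c + x * x)). pose proof (phi_pos x).
  rewrite Rabs_right by nra. nra.
Qed.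

Lemma gauss_avg_bounds c : 0 <= gauss_avg g c <= 1.
Proof.
  pose proof (is_RInt_line_gauss_avg c) as H. split.
  - replace 0 with (0 * 1) by ring.
    apply (is_RInt_line_le (fun x => 0 * phi x) _ _ _ (is_RInt_line_scal _ _ 0 is_RInt_line_phi) H).
    intros x. pose proof (phi_pos x). pose proof (g_bounds (c + x * x)). nra.
  - apply (is_RInt_line_le _ phi _ _ H is_RInt_line_phi).
    intros x. pose proof (phi_pos x). pose proof (g_bounds (c + x * x)). nra.
Qed.

Lemma gauss_avg_holder_half : holder_half g -> holder_half (gauss_avg g).
Proof.
  intros Hg c c'. set (q := sqrt (Rabs (c - c'))).
  assert (Hdiff : is_RInt_line (fun x => phi x * g (c + x * x) + -1 * (phi x * g (c' + x * x)))
                    (gauss_avg g c + -1 * gauss_avg g c'))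
    by (apply is_RInt_line_plus; [|apply is_RInt_line_scal]; apply is_RInt_line_gauss_avg).
  assert (Hpt : forall x, Rabs (phi x * g (c + x * x) + -1 * (phi x * g (c' + x * x)))
                          <= q * phi x).
  { intros x. pose proof (phi_pos x).
    replace (phi x * g (c + x * x) + -1 * (phi x * g (c' + x * x)))
      with (phi x * (g (c + x * x) - g (c' + x * x))) by ring.
    rewrite Rabs_mult, Rabs_right, Rmult_comm by lra.
    apply Rmult_le_compat_r; [lra|].
    unfold q. replace (c - c') with ((c + x * x) - (c' + x * x)) by ring. apply Hg. }
  pose proof (is_RInt_line_scal _ _ q is_RInt_line_phi) as Hq. rewrite Rmult_1_r in Hq.
  apply Rabs_le_between. split.
  - pose proof (is_RInt_line_le _ _ _ _ (is_RInt_line_scal _ _ (-1) Hdiff) Hq) as L.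
    enough (-1 * (gauss_avg g c + -1 * gauss_avg g c') <= q) by lra.
    apply L. intros x. specialize (Hpt x). apply Rabs_le_between in Hpt. lra.
  - pose proof (is_RInt_line_le _ _ _ _ Hdiff Hq) as L.
    enough (gauss_avg g c + -1 * gauss_avg g c' <= q) by lra.
    apply L. intros x. specialize (Hpt x). apply Rabs_le_between in Hpt. lra.
Qed.

End GaussAvg.

Definition phi_mass (s : R) := RInt phi (- s) s.

Lemma phi_mass_lipschitz s s' : 0 <= s -> 0 <= s' ->
  Rabs (phi_mass s - phi_mass s') <= Rabs (s - s').
Proof.
  intros Hs Hs'. unfold phi_mass.
  assert (Hsmall : forall u v, Rabs (RInt phi u v) <= Rabs (v - u) * / 2).
  { intros u v. apply (norm_RInt_le_const_abs (V := R_NormedModule) phi u v).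
    - intros x _. change (Rabs (phi x) <= / 2).
      rewrite Rabs_right by (left; apply phi_pos). apply phi_le_half.
    - apply (RInt_correct (V := R_CompleteNormedModule)), ex_RInt_phi. }
  pose proof (RInt_Chasles_R phi (- s) (- s') s (ex_RInt_phi _ _) (ex_RInt_phi _ _)).
  pose proof (RInt_Chasles_R phi (- s') s' s (ex_RInt_phi _ _) (ex_RInt_phi _ _)).
  replace (RInt phi (- s) s - RInt phi (- s') s')
    with (RInt phi (- s) (- s') + RInt phi s' s) by lra.
  pose proof (Hsmall (- s) (- s')). pose proof (Hsmall s' s).
  pose proof (Rabs_triang (RInt phi (- s) (- s')) (RInt phi s' s)).
  replace (- s' - - s) with (s - s') in * by ring.
  rewrite (Rabs_minus_sym s s') in *. lra.
Qed.

Section ChiSquareTail.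

Variable r : R.
Hypothesis r_ge0 : 0 <= r.

Definition above (t : R) := if Rlt_dec r (sqrt t) then 1 else 0.

Lemma above_sqrt_iff t : r < sqrt t <-> r * r < t.
Proof.
  split; intros H.
  - destruct (Rle_dec t 0); [rewrite sqrt_neg_0 in H by auto; lra|].
    rewrite <- (sqrt_sqrt t) by lra. pose proof (sqrt_pos t). nra.
  - rewrite <- (sqrt_square r) by auto. apply sqrt_lt_1_alt. nra.
Qed.

Lemma above_1 t : r * r < t -> above t = 1.
Proof.
  intros H. unfold above. destruct (Rlt_dec r (sqrt t)) as [|n]; auto.
  exfalso; apply n, above_sqrt_iff, H.
Qed.

Lemma above_0 t : t <= r * r -> above t = 0.
Proof.
  intros H. unfold above. destruct (Rlt_dec r (sqrt t)) as [h|]; auto.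
  apply above_sqrt_iff in h; lra.
Qed.

Lemma above_bounds t : 0 <= above t <= 1.
Proof. unfold above; destruct (Rlt_dec r (sqrt t)); lra. Qed.

Definition cut (c : R) := sqrt (Rmax 0 (r * r - c)).

Lemma cut_sq c : cut c * cut c = Rmax 0 (r * r - c).
Proof. apply sqrt_sqrt, Rmax_l. Qed.

Lemma phi_above_outside c x : cut c < Rabs x -> phi x * above (c + x * x) = phi x.
Proof.
  intros H. rewrite above_1; [ring|].
  pose proof (sqrt_pos (Rmax 0 (r * r - c))). pose proof (cut_sq c).
  pose proof (Rmax_r 0 (r * r - c)).
  pose proof (Rsqr_abs x). unfold Rsqr, cut in *. nra.
Qed.

Lemma phi_above_inside c x : Rabs x < cut c -> phi x * above (c + x * x) = 0.
Proof.
  intros H. rewrite above_0; [ring|].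
  pose proof (cut_sq c). pose proof (Rabs_pos x). pose proof (Rsqr_abs x). unfold Rsqr in *.
  assert (0 < Rmax 0 (r * r - c)) by nra.
  unfold Rmax in *. destruct (Rle_dec 0 (r * r - c)); nra.
Qed.

Lemma RInt_phi_above c a b : a <= - cut c -> cut c <= b ->
  ex_RInt (fun x => phi x * above (c + x * x)) a b /\
  RInt (fun x => phi x * above (c + x * x)) a b = RInt phi a b - phi_mass (cut c).
Proof.
  intros Ha Hb. assert (Hs : 0 <= cut c) by apply sqrt_pos. unfold phi_mass.
  set (s := cut c) in *. set (f := fun x => phi x * above (c + x * x)).
  destruct (ex_RInt_RInt_ext_R f phi a (- s)) as [X1 I1]; [lra| |apply ex_RInt_phi|].
  { intros x Hx. apply phi_above_outside. rewrite Rabs_left; fold s; lra. }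
  destruct (ex_RInt_RInt_ext_R f (fun _ => 0) (- s) s) as [X2 I2];
    [lra| |apply ex_RInt_const|].
  { intros x Hx. apply phi_above_inside. apply Rabs_def1; fold s; lra. }
  destruct (ex_RInt_RInt_ext_R f phi s b) as [X3 I3]; [lra| |apply ex_RInt_phi|].
  { intros x Hx. apply phi_above_outside. rewrite Rabs_right; fold s; lra. }
  rewrite RInt_const_R, Rmult_0_r in I2.
  assert (X12 : ex_RInt f a s) by (apply (ex_RInt_Chasles_R _ _ (- s)); auto).
  split; [apply (ex_RInt_Chasles_R _ _ s); auto|].
  rewrite <- (RInt_Chasles_R f a s b), <- (RInt_Chasles_R f a (- s) s) by auto.
  rewrite <- (RInt_Chasles_R phi a (- s) b), <- (RInt_Chasles_R phi (- s) s b)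
    by apply ex_RInt_phi.
  lra.
Qed.

Lemma avg_integrable_above : avg_integrable above.
Proof.
  intros c a b. set (N := Rabs a + Rabs b + cut c).
  pose proof (Rabs_pos a). pose proof (Rabs_pos b). pose proof (sqrt_pos (Rmax 0 (r * r - c))).
  fold (cut c) in *.
  apply (ex_RInt_sub _ N); [apply RInt_phi_above | |]; unfold N; lra.
Qed.

Lemma gauss_avg_above c : gauss_avg above c = 1 - phi_mass (cut c).
Proof.
  apply (is_RInt_line_unique (fun x => phi x * above (c + x * x))).
  - apply is_RInt_line_gauss_avg; [apply above_bounds | apply avg_integrable_above].
  - split; [apply avg_integrable_above|].
    intros eps Heps. destruct is_RInt_line_phi as [_ Hphi].
    destruct (Hphi eps Heps) as [M HM].
    pose proof (Rmax_l M (cut c)). pose proof (Rmax_r M (cut c)).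
    exists (Rmax M (cut c)). intros a b Ha Hb.
    rewrite (proj2 (RInt_phi_above c a b ltac:(lra) ltac:(lra))).
    replace (RInt phi a b - phi_mass (cut c) - (1 - phi_mass (cut c))) with (RInt phi a b - 1)
      by ring.
    apply HM; lra.
Qed.

Lemma gauss_avg_above_holder_half : holder_half (gauss_avg above).
Proof.
  intros c c'. rewrite !gauss_avg_above.
  replace (1 - phi_mass (cut c) - (1 - phi_mass (cut c')))
    with (- (phi_mass (cut c) - phi_mass (cut c'))) by ring.
  rewrite Rabs_Ropp. eapply Rle_trans; [apply phi_mass_lipschitz; apply sqrt_pos|].
  unfold cut. eapply Rle_trans; [apply sqrt_holder_half|].
  replace (r * r - c - (r * r - c')) with (- (c - c')) by ring. rewrite Rabs_Ropp. lra.
Qed.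

(** [chi2_tail n c] is the probability that [c + X_1^2 + ... + X_n^2 > r^2]. *)
Fixpoint chi2_tail (n : nat) : R -> R :=
  match n with
  | O => above
  | S m => gauss_avg (chi2_tail m)
  end.

Lemma chi2_tail_regular n :
  (forall t, 0 <= chi2_tail n t <= 1) /\ avg_integrable (chi2_tail n) /\
  ((1 <= n)%nat -> holder_half (chi2_tail n)).
Proof.
  induction n as [|[|n] IH].
  - split; [apply above_bounds|]. split; [apply avg_integrable_above | intros; lia].
  - assert (Hh : holder_half (chi2_tail 1)) by apply gauss_avg_above_holder_half.
    split; [apply gauss_avg_bounds; [apply above_bounds | apply avg_integrable_above]|].
    split; [apply avg_integrable_holder_half, Hh | auto].
  - destruct IH as [Hb [Hi Hh]].
    assert (Hh' : holder_half (chi2_tail (S (S n))))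
      by (apply gauss_avg_holder_half; auto; apply Hh; lia).
    split; [apply gauss_avg_bounds; auto|].
    split; [apply avg_integrable_holder_half, Hh' | auto].
Qed.

Lemma is_RInt_line_chi2_tail n c :
  is_RInt_line (fun x => phi x * chi2_tail n (c + x * x)) (chi2_tail (S n) c).
Proof.
  destruct (chi2_tail_regular n) as [Hb [Hi _]]. apply is_RInt_line_gauss_avg; auto.
Qed.

End ChiSquareTail.

Lemma iter_int_radial_tail r (hr : 0 <= r) n : forall c A f,
  (forall v, f v = if Rlt_dec r (sqrt (c + sqnorm v)) then A * exp (- (c + sqnorm v) / 2) else 0) ->
  iter_int n f (A * exp (- c / 2) * sqrt (2 * PI) ^ n * chi2_tail r n c).
Proof.
  induction n as [|n IH]; intros c A f Hf; simpl.
  - rewrite Hf. simpl. unfold above. rewrite Rplus_0_r.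
    destruct (Rlt_dec r (sqrt c)); ring.
  - exists (fun x => A * exp (- (c + x * x) / 2) * sqrt (2 * PI) ^ n * chi2_tail r n (c + x * x)).
    split.
    + intros x. apply IH. intros v. rewrite Hf. simpl. rewrite Rplus_assoc. reflexivity.
    + apply improper_int_of_is_RInt_line.
      eapply is_RInt_line_ext;
        [|exact (is_RInt_line_scal _ _ (A * exp (- c / 2) * sqrt (2 * PI) ^ S n)
                   (is_RInt_line_chi2_tail r hr n c))].
      intros x. simpl. unfold phi.
      replace (- (c + x * x) / 2) with (- c / 2 + - (x * x) / 2) by field.
      rewrite exp_plus. pose proof sqrt_2PI_ge2. field. lra.
Qed.

Lemma gauss_tail_chi2_tail d t0 : 0 <= t0 -> gauss_tail d (sqrt t0) (chi2_tail (sqrt t0) d 0).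
Proof.
  intros Ht0. pose proof sqrt_2PI_ge2.
  replace (chi2_tail (sqrt t0) d 0) with
    (/ sqrt (2 * PI) ^ d * exp (- 0 / 2) * sqrt (2 * PI) ^ d * chi2_tail (sqrt t0) d 0).
  2: { replace (- 0 / 2) with 0 by field. rewrite exp_0. field. apply pow_nonzero. lra. }
  apply iter_int_radial_tail; [apply sqrt_pos|].
  intros v. rewrite Rplus_0_l. unfold enorm, gauss_density.
  destruct (Rlt_dec (sqrt t0) (sqrt (sqnorm v))); [unfold Rdiv; ring | reflexivity].
Qed.

(** * Moments of the standard normal density *)

Lemma exp_INR_mult n z : exp (INR n * z) = exp z ^ n.
Proof.
  induction n as [|n IH]; [simpl; rewrite Rmult_0_l; apply exp_0|].
  rewrite S_INR, Rmult_plus_distr_r, Rmult_1_l, exp_plus, IH. simpl. ring.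
Qed.

Lemma exp_ge_pow8 y : 0 <= y -> (y / 8) ^ 8 <= exp y.
Proof.
  intros Hy. replace y with (INR 8 * (y / 8)) at 2 by (simpl; field).
  rewrite exp_INR_mult. apply pow_incr. pose proof (exp_ineq1_le (y / 8)). lra.
Qed.

Lemma pow_phi_vanishes j : (j <= 7)%nat -> forall eps, 0 < eps ->
  exists M, forall x, M <= Rabs x -> Rabs (x ^ j * phi x) <= eps.
Proof.
  intros Hj eps Heps. set (C := 4294967296).
  exists (Rmax 1 (C / eps)). intros x Hx.
  pose proof (Rmax_l 1 (C / eps)) as HM1. pose proof (Rmax_r 1 (C / eps)) as HM2.
  set (a := Rabs x) in *.
  assert (Ha7 : 0 < a ^ 7) by (apply pow_lt; lra).
  assert (Ha8 : 1 <= a ^ 8) by (apply pow_R1_Rle; lra).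
  assert (Hxx : x * x = a * a) by (pose proof (Rsqr_abs x); unfold Rsqr in *; auto).
  (* [exp (a^2/2) >= (a^2/16)^8 = a^16 / C] *)
  assert (Hexp : exp (- (x * x) / 2) <= C / (a ^ 7 * a ^ 8 * a)).
  { pose proof (exp_ge_pow8 (a * a / 2) ltac:(nra)) as H.
    replace ((a * a / 2 / 8) ^ 8) with (a ^ 7 * a ^ 8 * a / C) in H
      by (unfold C; rewrite <- !pow_add; simpl; field).
    rewrite Hxx. replace (- (a * a) / 2) with (- (a * a / 2)) by field. rewrite exp_Ropp.
    replace (C / (a ^ 7 * a ^ 8 * a)) with (/ (a ^ 7 * a ^ 8 * a / C))
      by (field; unfold C; lra).
    apply Rinv_le_contravar; [apply Rdiv_lt_0_compat; unfold C; nra | exact H]. }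
  rewrite Rabs_mult, <- RPow_abs, (Rabs_right (phi x)) by (left; apply phi_pos). fold a.
  assert (Haj : a ^ j <= a ^ 7) by (apply Rle_pow; auto; lra).
  apply Rle_trans with (a ^ 7 * (C / (a ^ 7 * a ^ 8 * a))).
  - apply Rmult_le_compat; [apply pow_le; lra | left; apply phi_pos | exact Haj |].
    eapply Rle_trans; [apply phi_le_exp | exact Hexp].
  - replace (a ^ 7 * (C / (a ^ 7 * a ^ 8 * a))) with (C / (a ^ 8 * a)) by (field; lra).
    apply Rle_trans with (C / (C / eps)); [|right; field; unfold C; lra].
    unfold Rdiv. apply Rmult_le_compat_l; [unfold C; lra|].
    apply Rinv_le_contravar; [apply Rdiv_lt_0_compat; unfold C; lra | nra].
Qed.

Lemma ex_RInt_phi_pow m a b : ex_RInt (fun x => phi x * x ^ m) a b.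
Proof.
  apply ex_RInt_continuous_R; intros; apply ex_derive_continuous_R.
  unfold phi; auto_derive; auto.
Qed.

(* Integration by parts against [phi' x = - x phi x]. *)
Lemma RInt_phi_pow_SS m a b :
  RInt (fun x => phi x * x ^ S (S m)) a b =
  - (b ^ S m * phi b) + a ^ S m * phi a + INR (S m) * RInt (fun x => phi x * x ^ m) a b.
Proof.
  assert (E : RInt (fun x => phi x * x ^ S (S m) + - INR (S m) * (phi x * x ^ m)) a b
              = - (b ^ S m * phi b) - - (a ^ S m * phi a)).
  { apply is_RInt_unique.
    apply (is_RInt_derive (V := R_CompleteNormedModule) (fun x => - (x ^ S m * phi x))).
    - intros x _. unfold phi. auto_derive; auto.
      pose proof sqrt_2PI_ge2. destruct m; simpl; unfold Rdiv; field; lra.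
    - intros x _. apply ex_derive_continuous_R. unfold phi. auto_derive. auto. }
  rewrite RInt_plus_R in E; [|apply ex_RInt_phi_pow | apply ex_RInt_scal_R, ex_RInt_phi_pow].
  rewrite RInt_scal_R in E by apply ex_RInt_phi_pow.
  lra.
Qed.

Lemma is_RInt_line_phi_pow_SS m L : (m <= 6)%nat ->
  is_RInt_line (fun x => phi x * x ^ m) L ->
  is_RInt_line (fun x => phi x * x ^ S (S m)) (INR (S m) * L).
Proof.
  intros Hm [_ Hlim]. split; [intros; apply ex_RInt_phi_pow|]. intros eps Heps.
  assert (Hs : 0 < INR (S m)) by (apply lt_0_INR; lia).
  destruct (Hlim (eps / (2 * INR (S m)))) as [M1 HM1]; [apply Rdiv_lt_0_compat; lra|].
  destruct (pow_phi_vanishes (S m) ltac:(lia) (eps / 4)) as [M2 HM2]; [lra|].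
  pose proof (Rmax_l M1 M2). pose proof (Rmax_r M1 M2).
  exists (Rmax M1 M2). intros a b Ha Hb. rewrite RInt_phi_pow_SS.
  pose proof (HM2 a ltac:(pose proof (Rabs_maj2 a); lra)) as Ta.
  pose proof (HM2 b ltac:(pose proof (Rle_abs b); lra)) as Tb.
  apply Rabs_le_between in Ta. apply Rabs_le_between in Tb.
  pose proof (HM1 a b ltac:(lra) ltac:(lra)) as P. apply Rabs_def2 in P.
  assert (Q : Rabs (INR (S m) * (RInt (fun x => phi x * x ^ m) a b - L)) < eps / 2).
  { rewrite Rabs_mult, Rabs_right by lra.
    apply Rlt_le_trans with (INR (S m) * (eps / (2 * INR (S m)))); [|right; field; lra].
    apply Rmult_lt_compat_l; [lra|]. apply Rabs_def1; lra. }
  apply Rabs_def2 in Q. apply Rabs_def1; lra.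
Qed.

Lemma is_RInt_line_phi_pow0 : is_RInt_line (fun x => phi x * x ^ 0) 1.
Proof. apply (is_RInt_line_ext phi); [intros; simpl; ring | apply is_RInt_line_phi]. Qed.

Lemma is_RInt_line_phi_pow2 : is_RInt_line (fun x => phi x * x ^ 2) 1.
Proof.
  replace 1 with (INR 1 * 1) by (simpl; ring).
  apply is_RInt_line_phi_pow_SS; [lia | apply is_RInt_line_phi_pow0].
Qed.

Lemma is_RInt_line_phi_pow4 : is_RInt_line (fun x => phi x * x ^ 4) 3.
Proof.
  replace 3 with (INR 3 * 1) by (simpl; ring).
  apply is_RInt_line_phi_pow_SS; [lia | apply is_RInt_line_phi_pow2].
Qed.

Lemma is_RInt_line_phi_pow6 : is_RInt_line (fun x => phi x * x ^ 6) 15.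
Proof.
  replace 15 with (INR 5 * 3) by (simpl; ring).
  apply is_RInt_line_phi_pow_SS; [lia | apply is_RInt_line_phi_pow4].
Qed.

Lemma is_RInt_line_phi_pow8 : is_RInt_line (fun x => phi x * x ^ 8) 105.
Proof.
  replace 105 with (INR 7 * 15) by (simpl; ring).
  apply is_RInt_line_phi_pow_SS; [lia | apply is_RInt_line_phi_pow6].
Qed.

Lemma is_RInt_line_phi_even_poly e0 e1 e2 e3 e4 :
  is_RInt_line (fun x => phi x * (e0 + e1 * x ^ 2 + e2 * x ^ 4 + e3 * x ^ 6 + e4 * x ^ 8))
    (e0 + e1 + 3 * e2 + 15 * e3 + 105 * e4).
Proof.
  pose proof (is_RInt_line_scal _ _ e0 is_RInt_line_phi_pow0) as A0.
  pose proof (is_RInt_line_scal _ _ e1 is_RInt_line_phi_pow2) as A1.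
  pose proof (is_RInt_line_scal _ _ e2 is_RInt_line_phi_pow4) as A2.
  pose proof (is_RInt_line_scal _ _ e3 is_RInt_line_phi_pow6) as A3.
  pose proof (is_RInt_line_scal _ _ e4 is_RInt_line_phi_pow8) as A4.
  pose proof (is_RInt_line_plus _ _ _ _ (is_RInt_line_plus _ _ _ _
    (is_RInt_line_plus _ _ _ _ (is_RInt_line_plus _ _ _ _ A0 A1) A2) A3) A4) as S.
  replace (e0 + e1 + 3 * e2 + 15 * e3 + 105 * e4)
    with (e0 * 1 + e1 * 1 + e2 * 3 + e3 * 15 + e4 * 105) by ring.
  eapply is_RInt_line_ext; [|exact S]. intros x. simpl. ring.
Qed.

(** * A polynomial minorant of the tail *)

(* [E (y + Z)^k] for [Z] chi-square with [N] degrees of freedom, whose moments are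
   [N], [N (N+2)], [N (N+2) (N+4)] and [N (N+2) (N+4) (N+6)]. *)
Definition chi2_mom1 N y := y + N.
Definition chi2_mom2 N y := y * y + 2 * y * N + N * (N + 2).
Definition chi2_mom3 N y := y * y * y + 3 * y * y * N + 3 * y * N * (N + 2) + N * (N + 2) * (N + 4).
Definition chi2_mom4 N y := y * y * y * y + 4 * y * y * y * N + 6 * y * y * N * (N + 2)
  + 4 * y * N * (N + 2) * (N + 4) + N * (N + 2) * (N + 4) * (N + 6).

(** [poly_avg a1 a2 a3 a4 t0 n c] is [E p(c + Z)] for [Z] chi-square with [n] degrees of
    freedom and [p t = a1 (t - t0) + a2 (t - t0)^2 + a3 (t - t0)^3 + a4 (t - t0)^4]. *)
Definition poly_avg (a1 a2 a3 a4 t0 : R) (n : nat) (c : R) :=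
  a1 * chi2_mom1 (INR n) (c - t0) + a2 * chi2_mom2 (INR n) (c - t0)
  + a3 * chi2_mom3 (INR n) (c - t0) + a4 * chi2_mom4 (INR n) (c - t0).

Lemma is_RInt_line_poly_avg a1 a2 a3 a4 t0 n c :
  is_RInt_line (fun x => phi x * poly_avg a1 a2 a3 a4 t0 n (c + x * x))
    (poly_avg a1 a2 a3 a4 t0 (S n) c).
Proof.
  set (N := INR n). set (y := c - t0).
  (* coefficients of [poly_avg a1 a2 a3 a4 t0 n (c + x^2)] as a polynomial in [x^2] *)
  set (e0 := a1 * chi2_mom1 N y + a2 * chi2_mom2 N y + a3 * chi2_mom3 N y + a4 * chi2_mom4 N y).
  set (e1 := a1 + 2 * a2 * chi2_mom1 N y + 3 * a3 * chi2_mom2 N y + 4 * a4 * chi2_mom3 N y).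
  set (e2 := a2 + 3 * a3 * chi2_mom1 N y + 6 * a4 * chi2_mom2 N y).
  set (e3 := a3 + 4 * a4 * chi2_mom1 N y).
  replace (poly_avg a1 a2 a3 a4 t0 (S n) c) with (e0 + e1 + 3 * e2 + 15 * e3 + 105 * a4).
  2: { unfold poly_avg, e0, e1, e2, e3, N, y. rewrite S_INR.
       unfold chi2_mom1, chi2_mom2, chi2_mom3, chi2_mom4. ring. }
  eapply is_RInt_line_ext; [|apply (is_RInt_line_phi_even_poly e0 e1 e2 e3 a4)].
  intros x. f_equal. unfold poly_avg, e0, e1, e2, e3, N, y.
  unfold chi2_mom1, chi2_mom2, chi2_mom3, chi2_mom4. simpl. ring.
Qed.

Lemma poly_avg_le_chi2_tail a1 a2 a3 a4 t0 r : 0 <= r ->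
  (forall t, poly_avg a1 a2 a3 a4 t0 0 t <= above r t) ->
  forall n c, poly_avg a1 a2 a3 a4 t0 n c <= chi2_tail r n c.
Proof.
  intros Hr H0 n. induction n as [|n IH]; intros c; [apply H0|].
  apply (is_RInt_line_le _ _ _ _ (is_RInt_line_poly_avg a1 a2 a3 a4 t0 n c)
           (is_RInt_line_chi2_tail r Hr n c)).
  intros x. apply Rmult_le_compat_l; [left; apply phi_pos | apply IH].
Qed.

Lemma quartic_shape_bound u : 0 <= u <= 9 / 2 ->
  u * (9 / 2 - u) * ((u + 3 / 2) * (u + 3 / 2)) <= 125.
Proof.
  intros Hu. assert (P0 : 0 <= u * (9 / 2 - u)) by (apply Rmult_le_pos; lra).
  assert (0 <= (u + 3 / 2) * (u + 3 / 2)) by apply Rle_0_sqr.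
  assert (0 <= (u - 9 / 4) * (u - 9 / 4)) by apply Rle_0_sqr.
  destruct (Rle_dec u 3); [|destruct (Rle_dec u (15 / 4))].
  - assert (u * (9 / 2 - u) <= 81 / 16) by nra.
    assert ((u + 3 / 2) * (u + 3 / 2) <= 81 / 4) by nra.
    apply Rle_trans with (81 / 16 * (81 / 4)); [apply Rmult_le_compat|]; lra.
  - assert (u * (9 / 2 - u) <= 9 / 2) by nra.
    assert ((u + 3 / 2) * (u + 3 / 2) <= 441 / 16) by nra.
    apply Rle_trans with (9 / 2 * (441 / 16)); [apply Rmult_le_compat|]; lra.
  - assert (u * (9 / 2 - u) <= 45 / 16) by nra.
    assert ((u + 3 / 2) * (u + 3 / 2) <= 36) by nra.
    apply Rle_trans with (45 / 16 * 36); [apply Rmult_le_compat|]; lra.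
Qed.

(* The minorant [u (9/2 - u) (u + 3/2)^2 / 125] of the indicator of [u > 0], taken at
   [u = (t - t0) / k], expanded in powers of [t - t0]. *)
Definition minorant_avg (k t0 : R) :=
  poly_avg (/ 125 * (81 / 8) / k) (/ 125 * (45 / 4) / (k * k))
    (/ 125 * (3 / 2) / (k * k * k)) (- / 125 / (k * k * k * k)) t0.

Lemma minorant_le_above t0 k : 0 <= t0 -> 0 < k ->
  forall t, minorant_avg k t0 0 t <= above (sqrt t0) t.
Proof.
  intros Ht0 Hk t. set (u := (t - t0) / k).
  replace (minorant_avg k t0 0 t)
    with (/ 125 * (u * (9 / 2 - u) * ((u + 3 / 2) * (u + 3 / 2)))).
  2: { unfold minorant_avg, poly_avg, chi2_mom1, chi2_mom2, chi2_mom3, chi2_mom4, u.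
       change (INR 0) with 0. field. lra. }
  assert (Hr : sqrt t0 * sqrt t0 = t0) by (apply sqrt_sqrt; auto).
  assert (0 <= (u + 3 / 2) * (u + 3 / 2)) by apply Rle_0_sqr.
  destruct (Rle_dec t t0).
  - rewrite (above_0 (sqrt t0) (sqrt_pos t0)) by lra.
    assert (u <= 0) by (unfold u, Rdiv; pose proof (Rinv_0_lt_compat k Hk); nra).
    assert (u * (9 / 2 - u) * ((u + 3 / 2) * (u + 3 / 2)) <= 0) by nra. lra.
  - rewrite (above_1 (sqrt t0) (sqrt_pos t0)) by lra.
    assert (0 < u) by (apply Rdiv_lt_0_compat; lra).
    destruct (Rle_dec u (9 / 2)).
    + pose proof (quartic_shape_bound u ltac:(lra)). lra.
    + assert (u * (9 / 2 - u) <= 0) by nra.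
      assert (u * (9 / 2 - u) * ((u + 3 / 2) * (u + 3 / 2)) <= 0) by nra. lra.
Qed.

Section Evaluation.

Variable d : nat.
Variable k : R.
Hypothesis k_sq : k * k = 2 * INR d.
Hypothesis k_ge2 : 2 <= k.

Lemma minorant_avg_mean_ge : 1 / 33 <= minorant_avg k (INR d) d 0.
Proof.
  set (w := / k).
  assert (Hw : 0 < w <= 1 / 2).
  { split; [apply Rinv_0_lt_compat; lra|].
    replace (1 / 2) with (/ 2) by field. apply Rinv_le_contravar; lra. }
  replace (minorant_avg k (INR d) d 0) with (/ 125 * (33 / 4 + 6 * w - 24 * (w * w))).
  2: { unfold minorant_avg, poly_avg, chi2_mom1, chi2_mom2, chi2_mom3, chi2_mom4, w.
       replace (INR d) with (k * k / 2) by lra. field. lra. }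
  nra.
Qed.

Lemma minorant_avg_mean2_ge : 1 / 397 <= minorant_avg k (INR d + 2) d 0.
Proof.
  set (w := / k).
  assert (Hw : 0 < w <= 1 / 2).
  { split; [apply Rinv_0_lt_compat; lra|].
    replace (1 / 2) with (/ 2) by field. apply Rinv_le_contravar; lra. }
  replace (minorant_avg k (INR d + 2) d 0)
    with (/ 125 * (33 / 4 - 93 / 4 * w + 29 * (w * w) - 12 * (w * w * w) - 16 * (w * w * w * w))).
  2: { unfold minorant_avg, poly_avg, chi2_mom1, chi2_mom2, chi2_mom3, chi2_mom4, w.
       replace (INR d) with (k * k / 2) by lra. field. lra. }
  assert (w * w * w <= w * w / 2) by nra.
  assert (w * w * w * w <= w * w / 4) by nra.
  assert (33 / 4 - 93 / 4 * w + 19 * (w * w) >= 11 / 8) by nra.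
  lra.
Qed.

End Evaluation.

Theorem lemma1 (d : nat) (hd : (2 <= d)%nat) :
  exists p1 p2 : R,
    gauss_tail d (sqrt (INR d)) p1 /\ p1 >= 1 / 33 /\
    gauss_tail d (sqrt (INR d + 2)) p2 /\ p2 >= 1 / 397.
Proof.
  assert (Hd : 2 <= INR d) by (apply le_INR in hd; simpl in hd; lra).
  set (k := sqrt (2 * INR d)).
  assert (Hkk : k * k = 2 * INR d) by (apply sqrt_sqrt; lra).
  assert (Hk : 2 <= k).
  { unfold k. rewrite <- (sqrt_square 2) at 1 by lra. apply sqrt_le_1_alt. lra. }
  assert (Hlow : forall t0, 0 <= t0 -> minorant_avg k t0 d 0 <= chi2_tail (sqrt t0) d 0)
    by (intros; apply poly_avg_le_chi2_tail; [apply sqrt_pos | apply minorant_le_above; lra]).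
  exists (chi2_tail (sqrt (INR d)) d 0), (chi2_tail (sqrt (INR d + 2)) d 0).
  split; [apply gauss_tail_chi2_tail; lra|]. split.
  { pose proof (minorant_avg_mean_ge d k Hkk Hk). pose proof (Hlow (INR d) ltac:(lra)). lra. }
  split; [apply gauss_tail_chi2_tail; lra|].
  pose proof (minorant_avg_mean2_ge d k Hkk Hk). pose proof (Hlow (INR d + 2) ltac:(lra)). lra.
Qed.
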